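(* For all $n\in\mathbb{N}$ with $n\le 8$ and all finite nonempty $A\subseteq\mathbb{N}$, we have $|A\ast[n]|\ge n$.
   Context: $\mathbb{N}=\{1,2,3,\dots\}$ and $[n]=\{1,2,\dots,n\}$. For finite $A,B\subseteq\mathbb{N}$, $A\ast B$ is the set of $x\in\mathbb{N}$ for which the number of pairs $(a,b)\in A\times B$ with $ab=x$ is odd. (So $A\ast[n]=A\,\Delta\,(2\cdot A)\,\Delta\cdots\Delta\,(n\cdot A)$, where $\Delta$ is symmetric difference and $j\cdot A=\{ja:a\in A\}$.) *)

(* Defs.v *)
From mathcomp Require Import all_boot finmap.

Set Implicit Arguments.
Unset Strict Implicit.
Unset Printing Implicit Defensive.

Local Open Scope fset_scope.

(* The set of positive integers is represented inside [nat]; finite subsets of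
   it are the [A : {fset nat}] with [0 \notin A]. *)

Definition interval1 (n : nat) : {fset nat} := [fset i in iota 1 n].

Definition prod_pairs (A B : {fset nat}) (x : nat) : {fset nat * nat} :=
  [fset p in A `*` B | p.1 * p.2 == x].

(* Only products a * b can have a nonzero number of representations, so the
   ambient finite set loses nothing: see [in_oddprod]. *)
Definition oddprod (A B : {fset nat}) : {fset nat} :=
  [fset x in [fset p.1 * p.2 | p in A `*` B] | odd #|` prod_pairs A B x|].

Lemma in_interval1 n i : (i \in interval1 n) = (1 <= i <= n).
Proof. by rewrite inE mem_iota add1n ltnS. Qed.

Lemma in_oddprod A B x : (x \in oddprod A B) = odd #|` prod_pairs A B x|.
Proof.
rewrite !inE; apply: andb_idl; apply: contraTT => /negP xAB.
suff -> : prod_pairs A B x = fset0 by rewrite cardfs0.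
apply/fsetP => p; rewrite !inE; apply/negbTE/negP => /andP[pAB /eqP px].
by apply: xAB; apply/imfsetP; exists p; rewrite ?inE.
Qed.

Lemma oddprod_pos A B :
  0 \notin A -> 0 \notin B -> 0 \notin oddprod A B.
Proof.
move=> A0 B0; rewrite in_oddprod.
suff -> : prod_pairs A B 0 = fset0 by rewrite cardfs0.
apply/fsetP => p; rewrite !inE muln_eq0; apply/negbTE/negP.
move=> /andP[/andP[pA pB] /orP[] /eqP p0].
- by rewrite p0 (negPf A0) in pA.
- by rewrite p0 (negPf B0) in pB.
Qed.

(* Main.v *)
Require Import Defs.
From mathcomp Require Import all_boot finmap.
From HB Require Import structures.
From mathcomp Require Import zify.

(** Finite sets of positive integers, under symmetric difference and [oddprod],
    are polynomials over F_2 in one variable per prime: [a] is the monomial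
    given by its factorization, and the cardinal is the number of terms.  So the
    theorem bounds below the number of terms of every nonzero multiple of the
    polynomial of {1, ..., n}.

    Two tools do almost all the work.

    - Extreme levels ([weight_ge_split]).  For a prime p, the terms of A * B of
      least p-adic valuation are the product of those of A and those of B, and
      likewise for the greatest valuation.  If the valuations on B range from i
      to j > i, the two extreme parts of A * B are disjoint, so lower bounds for
      the extreme levels of B add up to a lower bound for B.

    - Parity ([weight_ge_even]).  Evaluation at (1, ..., 1) is multiplicative, so
      |A * B| is even as soon as |B| is, and an odd lower bound improves by one.

    When n is a prime, the first tool with p = n leads from {1, ..., n-1} to
    {1, ..., n} with one more term.  For n = 4 and n = 6 the first tool gives
    n - 1 and the second gives n.  For n = 8, splitting at 7 and parity reduce
    the claim to this: nonzero multiples of H + z have at least 6 terms, where H is the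
    polynomial of {1,2,3,4,6,8} and z is the variable of 5.  Splitting at 5 gives
    only 4 + 1.  If a multiple A (H + z) had exactly 5 terms, with
    A = sum_i A_i z^i for a <= i <= a', there would be no term strictly between
    the extreme powers of z, so A_(i-1) = H A_i for all a < i <= a', while A_a'
    would be a monomial.  Then the four lowest terms would be, up to a monomial,
    those of a power H^k, k > 0 ([weight_ge_adjoin_prime]).

    But H^k has more than four terms ([card_oddexp_H]).  Indeed
    H = (1+x)^3 + y (1+x), with x and y the variables of 2 and 3, so the extreme
    parts in y of H^k are (1+x)^(3k) and y^k (1+x)^k, each with at least two
    terms; and if (1+x)^k has exactly two, it is 1 + x^k, whose cube has four. *)

Set Implicit Arguments.
Unset Strict Implicit.
Unset Printing Implicit Defensive.

Local Open Scope fset_scope.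
Local Open Scope nat_scope.

Local Notation "A ** B" := (oddprod A B) (at level 40, left associativity).
Local Notation xsum A F := (\big[addb/false]_(x <- A) F x).

(** * Sums modulo 2 over finite sets *)

Lemma xsum_mem (A : {fset nat}) y :
  \big[addb/false]_(x <- A) (x == y) = (y \in A).
Proof.
case: (boolP (y \in A)) => yA; last first.
  by rewrite big_seq big1 // => x xA; apply: contraNF yA => /eqP <-.
rewrite (big_fsetD1 y) //= eqxx big_seq big1 // => x.
by rewrite !inE => /andP[/negPf ->].
Qed.

(** A set is handled through the linear functional [F |-> xsum A F] on functions
    [nat -> bool]: it determines the set ([fset_xsumP]), and it turns [oddprod]
    into an iterated sum ([xsum_oddprod]), so that identities between products
    become pointwise identities under the sum sign. *)
Lemma fset_xsumP (A B : {fset nat}) :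
  (forall F : nat -> bool, xsum A F = xsum B F) -> A = B.
Proof.
by move=> eqAB; apply/fsetP => y; rewrite -!xsum_mem; apply: (eqAB (eq_op^~ y)).
Qed.

Lemma xsum_true (A : {fset nat}) : \big[addb/false]_(x <- A) true = odd #|` A|.
Proof. by elim: (enum_fset A) => [|x s IHs]; rewrite ?big_nil // big_cons IHs. Qed.

Lemma xsum_indicator (A X : {fset nat}) F : A `<=` X ->
  xsum A F = \big[addb/false]_(x <- X) ((x \in A) && F x).
Proof.
move=> sAX; rewrite -(big_fset_incl _ sAX) => [|x _ /negPf-> //].
by rewrite big_seq [RHS]big_seq; apply: eq_bigr => x ->.
Qed.

Lemma xsum_seq (s : seq nat) F : uniq s ->
  xsum [fset x in s] F = \big[addb/false]_(x <- s) F x.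
Proof.
move=> s_uniq; apply/perm_big/uniq_perm; rewrite ?fset_uniq // => x.
by rewrite inE.
Qed.

Lemma odd_count (T : Type) (a : pred T) (s : seq T) :
  odd (count a s) = \big[addb/false]_(x <- s) a x.
Proof.
by elim: s => [|x s IHs]; rewrite ?big_nil // big_cons -IHs /= oddD oddb.
Qed.

Lemma fset_gt0 (A : {fset nat}) a : 0 \notin A -> a \in A -> 0 < a.
Proof. by case: a => // /negPf->. Qed.

(** * The commutative monoid of finite sets under [oddprod] *)

Lemma mem_oddprodE A B x :
  (x \in A ** B)
    = \big[addb/false]_(a <- A) \big[addb/false]_(b <- B) (a * b == x).
Proof.
rewrite in_oddprod.
have -> : #|` prod_pairs A B x|
            = count (fun q => q.1 * q.2 == x) [seq (a, b) | a <- A, b <- B].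
  rewrite -size_filter; apply/perm_size/uniq_perm;
    rewrite ?fset_uniq ?filter_uniq //.
    by rewrite allpairs_uniq ?fset_uniq // => -[? ?] [? ?] _ _ /=.
  move=> [a b]; rewrite !inE /= mem_filter andbC; congr andb.
  apply/andP/allpairsP => [[aA bB]|[[a' b'] /= [aA bB [-> ->]]]] //.
  by exists (a, b).
by rewrite odd_count big_allpairs.
Qed.

Lemma oddprod_mem A B x :
  x \in A ** B -> exists a b, [/\ a \in A, b \in B & x = a * b].
Proof.
rewrite !inE => /andP[/imfsetP[[a b] /=]]; rewrite !inE => /andP[aA bB] -> _.
by exists a, b.
Qed.

Lemma xsum_oddprod A B F :
  xsum (A ** B) F
    = \big[addb/false]_(a <- A) \big[addb/false]_(b <- B) F (a * b).
Proof.
pose X := [fset q.1 * q.2 | q in A `*` B].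
have ABX : A ** B `<=` X by apply/fsubsetP => x; rewrite inE => /andP[].
rewrite (xsum_indicator _ ABX).
under eq_bigr do rewrite mem_oddprodE big_distrl /=.
rewrite exchange_big /= big_seq [RHS]big_seq; apply: eq_bigr => a aA.
under eq_bigr do rewrite big_distrl /=.
rewrite exchange_big /= big_seq [RHS]big_seq; apply: eq_bigr => b bB.
have abX : a * b \in X by apply/imfsetP; exists (a, b); rewrite ?inE ?aA.
rewrite (big_fsetD1 (a * b)) //= eqxx /= big_seq big1 ?addbF // => x.
by rewrite !inE eq_sym => /andP[/negPf ->].
Qed.

Lemma oddprodC : commutative oddprod.
Proof.
move=> A B; apply: fset_xsumP => F; rewrite !xsum_oddprod exchange_big /=.
by do 2!apply: eq_bigr => ? _; rewrite mulnC.
Qed.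

Lemma oddprodA : associative oddprod.
Proof.
move=> A B C; apply: fset_xsumP => F; rewrite !xsum_oddprod.
apply: eq_bigr => a _; rewrite xsum_oddprod.
by do 2!apply: eq_bigr => ? _; rewrite mulnA.
Qed.

Lemma oddprod1s : left_id [fset 1] oddprod.
Proof.
move=> A; apply: fset_xsumP => F; rewrite xsum_oddprod big_seq_fset1.
by apply: eq_bigr => a _; rewrite mul1n.
Qed.

HB.instance Definition _ :=
  Monoid.isComLaw.Build {fset nat} [fset 1] oddprod oddprodA oddprodC oddprod1s.

Lemma odd_card_oddprod A B : odd #|` A ** B| = odd #|` A| && odd #|` B|.
Proof.
rewrite -!xsum_true (xsum_oddprod _ _ (fun=> true)) big_distrl /=.
by apply: eq_bigr => a _; rewrite xsum_true.
Qed.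

Lemma card_oddprod_set1 (A : {fset nat}) c :
  0 < c -> #|` A ** [fset c]| = #|` A|.
Proof.
move=> c0; suff -> : A ** [fset c] = [fset a * c | a in A].
  by rewrite card_in_imfset // => x y _ _ /eqP; rewrite eqn_pmul2r // => /eqP.
apply: fset_xsumP => F; rewrite xsum_oddprod big_imfset /=; last first.
  by move=> x y _ _ /eqP; rewrite eqn_pmul2r // => /eqP.
by apply: eq_bigr => a _; rewrite big_seq_fset1.
Qed.

Lemma oddprod_set1 a b : [fset a] ** [fset b] = [fset a * b].
Proof. by apply: fset_xsumP => F; rewrite xsum_oddprod !big_seq_fset1. Qed.

Definition oddexp (A : {fset nat}) k := \big[oddprod/[fset 1]]_(i < k) A.

Local Notation "A ^** k" := (oddexp A k) (at level 30).

Lemma oddexp0 A : A ^** 0 = [fset 1].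
Proof. exact: big_ord0. Qed.

Lemma oddexpS A k : A ^** k.+1 = A ** A ^** k.
Proof. exact: big_ord_recl. Qed.

Lemma oddexpMn A B k : (A ** B) ^** k = A ^** k ** B ^** k.
Proof. exact: big_split. Qed.

Lemma oddexp_set1 c k : [fset c] ^** k = [fset c ^ k].
Proof.
by elim: k => [|k IHk]; rewrite ?oddexp0 // oddexpS IHk oddprod_set1 expnS.
Qed.

(** * Levels of a set for a p-adic valuation *)

Definition level p i (A : {fset nat}) : {fset nat} :=
  [fset a in A | logn p a == i].

Lemma in_level p i A x : (x \in level p i A) = (x \in A) && (logn p x == i).
Proof. by rewrite !inE. Qed.

Lemma level_notin0 p i A : 0 \notin A -> 0 \notin level p i A.
Proof. by rewrite in_level => /negPf->. Qed.

Lemma level_seq p i (s : seq nat) :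
  level p i [fset x in s] = [fset x in [seq b <- s | logn p b == i]].
Proof. by apply/fsetP => x; rewrite !inE mem_filter andbC. Qed.

Lemma xsum_level p i A F :
  xsum (level p i A) F = \big[addb/false]_(a <- A) ((logn p a == i) && F a).
Proof.
by rewrite big_fset big_mkcond /=; apply: eq_bigr => a _; case: (_ == i).
Qed.

(** The hypothesis says that valuation [i + j] can be reached in a product only
    from [i] in [A] and [j] in [B].  This holds when [i] and [j] are both least,
    or both greatest, among the valuations on [A] and on [B]. *)
Lemma level_oddprod p i j A B : prime p -> 0 \notin A -> 0 \notin B ->
  {in A & B, forall a b,
     (logn p a + logn p b == i + j) = (logn p a == i) && (logn p b == j)} ->
  level p (i + j) (A ** B) = level p i A ** level p j B.
Proof.
move=> p_pr A0 B0 extr; apply: fset_xsumP => F.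
rewrite xsum_level (xsum_oddprod _ _ (fun x => (logn p x == i + j) && F x)).
rewrite xsum_oddprod (xsum_level _ _ _ (fun a => xsum _ (fun b => F (a * b)))).
rewrite big_seq [RHS]big_seq; apply: eq_bigr => a aA.
rewrite (xsum_level _ _ _ (fun b => F (a * b))) big_distrr /=.
rewrite big_seq [RHS]big_seq; apply: eq_bigr => b bB.
by rewrite lognM ?(fset_gt0 A0 aA) ?(fset_gt0 B0 bB) // extr // andbA.
Qed.

Lemma level_oddexp p i j B k : prime p -> 0 \notin B ->
  {in B, forall b, i <= logn p b <= j} ->
  [/\ 0 \notin B ^** k, {in B ^** k, forall x, k * i <= logn p x <= k * j},
      level p (k * i) (B ^** k) = level p i B ^** k &
      level p (k * j) (B ^** k) = level p j B ^** k].
Proof.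
move=> p_pr B0 Bij; elim: k => [|k [P0 Pij levi levj]].
  rewrite !oddexp0 !mul0n; have lev1 : level p 0 [fset 1] = [fset 1].
    apply/fsetP => x; rewrite in_level inE; apply: andb_idr => /eqP->.
    by rewrite logn1.
  by split; rewrite ?lev1 ?inE // => x; rewrite inE => /eqP->; rewrite logn1.
rewrite !oddexpS -levi -levj !mulSn; split.
- exact: oddprod_pos.
- move=> x /oddprod_mem[a [b [aB bP ->]]].
  rewrite lognM ?(fset_gt0 B0 aB) ?(fset_gt0 P0 bP) //.
  by have := Bij _ aB; have := Pij _ bP; lia.
- by rewrite level_oddprod // => x y /Bij ? /Pij ?; lia.
- by rewrite level_oddprod // => x y /Bij ? /Pij ?; lia.
Qed.

Lemma leq_sum_card_levels p (s : seq nat) A : uniq s ->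
  \sum_(i <- s) #|` level p i A| <= #|` A|.
Proof.
move=> s_uniq; rewrite card_fset_sum1.
under eq_bigr do rewrite card_fset_sum1 big_fset /= big_mkcond /=.
rewrite exchange_big /=; apply: leq_sum => a _.
rewrite -big_mkcond sum1_count (@eq_count _ _ (pred1 (logn p a))).
  by rewrite count_uniq_mem // leq_b1.
by move=> i; rewrite /= eq_sym.
Qed.

Lemma leq_card_levels p i j A : i != j ->
  #|` level p i A| + #|` level p j A| <= #|` A|.
Proof.
move=> neq_ij; have := @leq_sum_card_levels p [:: i; j] A.
by rewrite !big_cons big_nil addn0; apply; rewrite /= inE neq_ij.
Qed.

Lemma level_bounds p A : A != fset0 -> exists i j,
  [/\ i <= j, level p i A != fset0, level p j A != fset0 &
      {in A, forall a, i <= logn p a <= j}].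
Proof.
move=> /fset0Pn[a0 a0A].
have exi : exists i, has (fun a => logn p a == i) A.
  by exists (logn p a0); apply/hasP; exists a0.
have bnd i : has (fun a => logn p a == i) A -> i <= \max_(a <- A) logn p a.
  by move=> /hasP[a aA /eqP<-]; apply: leq_bigmax_seq.
case: (ex_minnP exi) => i /hasP[a aA va] imin.
case: (ex_maxnP exi bnd) => j /hasP[b bA vb] jmax.
exists i, j; split.
- by apply: imin; apply/hasP; exists b.
- by apply/fset0Pn; exists a; rewrite in_level aA.
- by apply/fset0Pn; exists b; rewrite in_level bA.
by move=> c cA; rewrite imin ?jmax //; apply/hasP; exists c.
Qed.

(** * Lower bounds for the cardinals of all multiples of a set *)

Definition weight_ge (B : {fset nat}) w :=
  forall A : {fset nat}, 0 \notin A -> A != fset0 -> w <= #|` A ** B|.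

Lemma weight_ge_set1 c : 0 < c -> weight_ge [fset c] 1.
Proof. by move=> c0 A _ A1; rewrite card_oddprod_set1 // cardfs_gt0. Qed.

Lemma weight_ge_even B w :
  ~~ odd #|` B| -> odd w -> weight_ge B w -> weight_ge B w.+1.
Proof.
move=> evB oddw wB A A0 A1; rewrite ltn_neqAle wB // andbT.
by apply: contraTneq oddw => ->; rewrite odd_card_oddprod (negPf evB) andbF.
Qed.

(** The lowest level of a multiple of [B] is a multiple of the lowest level of
    [B], its highest level is a multiple of the highest level of [B], and
    [i < j] keeps the two apart. *)
Lemma weight_ge_split p i j B u v : prime p -> i < j -> 0 \notin B ->
  {in B, forall b, i <= logn p b <= j} ->
  weight_ge (level p i B) u -> weight_ge (level p j B) v -> weight_ge B (u + v).
Proof.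
move=> p_pr ltij B0 Bij wi wj A A0 A1.
have [a [a' [leaa' Aa Aa' Aaa']]] := level_bounds p A1.
have neq : a + i != a' + j by lia.
apply: leq_trans (leq_card_levels p _ neq).
rewrite !level_oddprod //; first 1 last.
- by move=> x y /Aaa' ? /Bij ?; lia.
- by move=> x y /Aaa' ? /Bij ?; lia.
by rewrite leq_add // (wi, wj) // level_notin0.
Qed.

(** The form used on explicit sets, where the conditions and the two levels are
    found by computation. *)
Lemma weight_ge_split_seq p i j (s : seq nat) u v : prime p -> i < j ->
  all (fun b => (0 < b) && (i <= logn p b <= j)) s ->
  weight_ge [fset x in [seq b <- s | logn p b == i]] u ->
  weight_ge [fset x in [seq b <- s | logn p b == j]] v ->
  weight_ge [fset x in s] (u + v).
Proof.
move=> p_pr ltij /allP s_ij; rewrite -!level_seq; apply: weight_ge_split => //.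
  by rewrite inE; apply/negP => /s_ij.
by move=> b; rewrite inE => /s_ij /andP[].
Qed.

(** * Adjoining a prime *)

(** With [z] the variable of [p], the coefficient of [z^(i+1)] in
    [(sum_i A_i z^i) (B + z)] is [A_(i+1) B + A_i], and the equation below says
    that it vanishes.  The factor [p] on the right makes up for levels being
    kept inside [A] rather than divided by [p ^ i]. *)
Lemma level_oddprod_prime p i A B : prime p -> 0 \notin A ->
  0 \notin B -> {in B, forall b, logn p b = 0} ->
  level p i.+1 (A ** (p |` B)) = fset0 ->
  level p i.+1 A ** B = level p i A ** [fset p].
Proof.
move=> p_pr A0 B0 Bp lev0; apply: fset_xsumP => F.
have pB : p \notin B by apply/negP => /Bp; rewrite logn_prime // eqxx.
have : xsum (level p i.+1 (A ** (p |` B))) F = false.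
  by rewrite lev0 big_seq_fset0.
rewrite xsum_level (xsum_oddprod _ _ (fun x => (logn p x == i.+1) && F x)).
under eq_bigr do rewrite big_fsetU1 //=.
rewrite big_split /= addbC => /negbT; rewrite negb_add => /eqP lev_eq.
rewrite !xsum_oddprod (xsum_level _ _ _ (fun a => xsum B (fun b => F (a * b)))).
rewrite (xsum_level _ _ _ (fun a => xsum [fset p] (fun b => F (a * b)))).
transitivity (\big[addb/false]_(a <- A) \big[addb/false]_(b <- B)
                ((logn p (a * b) == i.+1) && F (a * b))).
  rewrite big_seq [RHS]big_seq; apply: eq_bigr => a /(fset_gt0 A0) a0.
  rewrite big_distrr big_seq [RHS]big_seq; apply: eq_bigr => b bB.
  by rewrite lognM ?(fset_gt0 B0 bB) // (Bp _ bB) addn0.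
rewrite lev_eq big_seq [RHS]big_seq; apply: eq_bigr => a /(fset_gt0 A0) a0.
rewrite big_seq_fset1 lognM ?(prime_gt0 p_pr) // (logn_prime p p_pr) eqxx.
by rewrite addn1 eqSS.
Qed.

(** Splitting at [p] yields [w + 1].  A multiple of [p |` B] with no more terms
    than that would live on its two extreme levels only, with [w] terms on the
    lowest and one on the highest; unrolling the equations of the empty
    intermediate levels down from the top identifies the lowest level, up to
    translation, with a power of [B]. *)
Lemma weight_ge_adjoin_prime p B w : prime p ->
  0 \notin B -> {in B, forall b, logn p b = 0} -> weight_ge B w ->
  (forall k, 0 < k -> w < #|` B ^** k|) -> weight_ge (p |` B) w.+2.
Proof.
move=> p_pr B0 Bp wB powB A A0 A1; have p0 := prime_gt0 p_pr.
have [a [a' [leaa' Aa Aa' Aaa']]] := level_bounds p A1.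
have pB : p \notin B by apply/negP => /Bp; rewrite logn_prime // eqxx.
have pB0 : 0 \notin p |` B by rewrite !inE negb_or B0 eq_sym -lt0n p0.
have pBlev : {in p |` B, forall b, logn p b = (b == p)}.
  move=> b; rewrite !inE => /predU1P[->|bB]; first by rewrite logn_prime // eqxx.
  by rewrite Bp //; case: eqP bB pB => // -> ->.
set C := A ** (p |` B).
have Clow : level p a C = level p a A ** B.
  rewrite -[a in LHS]addn0 level_oddprod //; last by move=> x y /Aaa' ? _; lia.
  congr (_ ** _); apply/fsetP => x; rewrite in_level.
  apply/andP/idP => [[xpB]|xB]; last by rewrite !inE xB orbT Bp.
  rewrite pBlev // eqb0; move: xpB.
  by rewrite !inE => /predU1P[->|//]; rewrite eqxx.
have Ctop : level p a'.+1 C = level p a' A ** [fset p].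
  rewrite -addn1 level_oddprod //; last first.
    by move=> x y /Aaa' ? yB; rewrite (pBlev _ yB); case: (y == p) => /=; lia.
  congr (_ ** _); apply/fsetP => x; rewrite in_level in_fset1.
  apply/andP/eqP => [[xpB]|->]; last by rewrite !inE logn_prime // eqxx.
  by rewrite pBlev // eqb1 => /eqP.
have low_ge : w <= #|` level p a C| by rewrite Clow wB // level_notin0.
have cardCtop : #|` level p a'.+1 C| = #|` level p a' A|.
  by rewrite Ctop card_oddprod_set1.
have top_ge : 0 < #|` level p a' A| by rewrite cardfs_gt0.
rewrite leqNgt; apply/negP => ltCw.
have neq_ends : a != a'.+1 by lia.
have leCw := leq_card_levels p C neq_ends.
have low_eq : #|` level p a C| = w by lia.
have top_eq : #|` level p a' A| = 1 by lia.
have mid i : a <= i < a' -> level p i.+1 A ** B = level p i A ** [fset p].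
  move=> aia'; apply: level_oddprod_prime => //; apply/eqP.
  rewrite -cardfs_eq0; have := @leq_sum_card_levels p [:: a; a'.+1; i.+1] C.
  rewrite !big_cons big_nil -/C => leC3.
  suff: uniq [:: a; a'.+1; i.+1] by move=> /leC3; lia.
  by rewrite /= !inE; lia.
(* The relation A_(a'-k) = B^k A_a'; the power of p restores valuation a'. *)
have chain k : k <= a' - a ->
    level p (a' - k) A ** [fset p] ^** k = level p a' A ** B ^** k.
  elim: k => [|k IHk] ltk; first by rewrite !oddexp0 subn0.
  rewrite !oddexpS oddprodA -mid; last by lia.
  have -> : (a' - k.+1).+1 = a' - k by lia.
  rewrite -oddprodA (oddprodC B) oddprodA IHk 1?ltnW //.
  by rewrite -oddprodA (oddprodC _ B).
have := chain _ (leqnn _); rewrite subKn // oddexp_set1 => chain_a.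
have := powB (a' - a).+1 isT; rewrite -low_eq Clow ltnNge => /negP; apply.
have /eqP/cardfs1P[M topM] := top_eq.
have M0 : 0 < M by apply: (fset_gt0 (level_notin0 p a' A0)); rewrite topM fset11.
have pk0 : 0 < p ^ (a' - a) by rewrite expn_gt0 p0.
rewrite -(card_oddprod_set1 (level p a A ** B) pk0).
rewrite -oddprodA (oddprodC B) oddprodA chain_a topM.
by rewrite -oddprodA (oddprodC _ B) -oddexpS oddprodC card_oddprod_set1.
Qed.

(** * Powers of {1, 2} and of {1, 2, 3, 4, 6, 8} *)

Local Notation E := [fset x in [:: 1; 2]].
Local Notation H := [fset x in [:: 1; 2; 3; 4; 6; 8]].

Lemma fset_seq1 (c : nat) : [fset x in [:: c]] = [fset c].
Proof. by apply/fsetP => x; rewrite in_fset1 !inE orbF. Qed.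

Lemma card_fset_seq (s : seq nat) : uniq s -> #|` [fset x in s]| = size s.
Proof. by move=> s_uniq; rewrite card_fseq undup_id. Qed.

(** Over F_2, (1 + t)^3 = 1 + t + t^2 + t^3. *)
Lemma oddprod_cube q : 1 < q ->
  [fset x in [:: 1; q]] ** ([fset x in [:: 1; q]] ** [fset x in [:: 1; q]])
    = [fset x in [:: 1; q; q * q; q * q * q]].
Proof.
move=> q1; apply: fset_xsumP => F.
have uq : uniq [:: 1; q] by rewrite /= !inE; lia.
rewrite xsum_oddprod [RHS]xsum_seq; last by rewrite /= !inE; nia.
under eq_bigr do (rewrite (xsum_oddprod _ _ (fun x => F (_ * x))) xsum_seq //;
  under eq_bigr do rewrite xsum_seq //).
rewrite xsum_seq // !(big_cons, big_nil) !mul1n !muln1 !mulnA.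
by do 4!case: (F _).
Qed.

Lemma level2_oddexp_E k :
  [/\ 0 \notin E ^** k, {in E ^** k, forall x, 0 <= logn 2 x <= k},
      level 2 0 (E ^** k) = [fset 1] & level 2 k (E ^** k) = [fset 2 ^ k]].
Proof.
have E0 : 0 \notin E by rewrite !inE.
have E01 : {in E, forall b, 0 <= logn 2 b <= 1}.
  by move=> b; rewrite !inE orbF => /orP[] /eqP->.
have := @level_oddexp 2 0 1 E k isT E0 E01.
by rewrite muln0 muln1 !level_seq /= !fset_seq1 !oddexp_set1 exp1n.
Qed.

Lemma weight_ge_oddexp_E k : 0 < k -> weight_ge (E ^** k) 2.
Proof.
move=> k0; have [P0 Pk lev0 levk] := level2_oddexp_E k.
apply: (@weight_ge_split 2 0 k _ 1 1) => //; rewrite ?lev0 ?levk.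
  exact: weight_ge_set1.
by apply: weight_ge_set1; rewrite expn_gt0.
Qed.

(** For the 3-adic valuation, the extreme levels of [H] are [E]^3 and 3 [E], so
    those of [H ^** k] are the cube of [P := E ^** k] and a translate of [P].
    Either [P] has at least three elements and its cube at least two, or
    [P = {1, 2 ^ k}] and its cube has four. *)
Lemma card_oddexp_H k : 0 < k -> 4 < #|` H ^** k|.
Proof.
move=> k0; have H0 : 0 \notin H by rewrite !inE.
have H01 : {in H, forall b, 0 <= logn 3 b <= 1}.
  by move=> b; rewrite !inE !orbF => /or4P[||| /or3P[]] /eqP->.
have [_ _] := @level_oddexp 3 0 1 H k isT H0 H01.
rewrite muln0 muln1 !level_seq /= -(@oddprod_cube 2) // !oddexpMn.
have -> : [fset x in [:: 3; 6]] = [fset 3] ** E.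
  by apply: fset_xsumP => F; rewrite xsum_oddprod big_seq_fset1 !xsum_seq // unlock.
rewrite oddexpMn oddexp_set1 => lev0 levk.
have k_neq0 : 0 != k by rewrite neq_ltn k0.
apply: leq_trans (leq_card_levels 3 _ k_neq0); rewrite lev0 levk.
rewrite (oddprodC [fset _]) card_oddprod_set1 ?expn_gt0 //.
have := level2_oddexp_E k; have := weight_ge_oddexp_E k0.
set P := E ^** k => wP [P0 _ Plev0 Plevk].
have P1 : 1 \in P by have := fset11 1; rewrite -Plev0 in_level => /andP[].
have Pq : 2 ^ k \in P.
  by have := fset11 (2 ^ k); rewrite -Plevk in_level => /andP[].
have q1 : 1 < 2 ^ k by rewrite -[1](expn0 2) ltn_exp2l.
have uq : uniq [:: 1; 2 ^ k] by rewrite /= inE; lia.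
have sP : [fset x in [:: 1; 2 ^ k]] `<=` P.
  by apply/fsubsetP => x; rewrite !inE orbF => /orP[] /eqP->.
have [leP2 | ltP2] := leqP #|` P| 2.
  have {sP} <- : [fset x in [:: 1; 2 ^ k]] = P.
    by apply/eqP; rewrite eqEfcard sP card_fset_seq.
  by rewrite oddprod_cube // !card_fset_seq //= !inE; nia.
have PP : 2 <= #|` P ** P| by apply: wP => //; apply/fset0Pn; exists 1.
have PPP : 2 <= #|` (P ** P) ** P|.
  apply: wP; first exact: oddprod_pos.
  by rewrite -cardfs_gt0; apply: ltnW.
by rewrite oddprodA; lia.
Qed.

(** * The intervals {1, ..., n} with n at most 8 *)

Lemma weight_ge_seq1 c : 0 < c -> weight_ge [fset x in [:: c]] 1.
Proof. by rewrite fset_seq1; apply: weight_ge_set1. Qed.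

Lemma weight_ge_124 : weight_ge [fset x in [:: 1; 2; 4]] 2.
Proof.
by apply: (@weight_ge_split_seq 2 0 2 _ 1 1); rewrite //=; apply: weight_ge_seq1.
Qed.

Lemma weight_ge_36 : weight_ge [fset x in [:: 3; 6]] 2.
Proof.
by apply: (@weight_ge_split_seq 2 0 1 _ 1 1); rewrite //=; apply: weight_ge_seq1.
Qed.

Lemma weight_ge_H : weight_ge H 4.
Proof.
apply: (@weight_ge_split_seq 3 0 1 _ 2 2) => //=; last exact: weight_ge_36.
by apply: (@weight_ge_split_seq 2 0 3 _ 1 1); rewrite //=; apply: weight_ge_seq1.
Qed.

Lemma weight_ge_interval4 : weight_ge (interval1 4) 4.
Proof.
apply: weight_ge_even; rewrite ?card_fset_seq //.
apply: (@weight_ge_split_seq 3 0 1 _ 2 1) => //=; first exact: weight_ge_124.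
exact: weight_ge_seq1.
Qed.

Lemma weight_ge_interval6 : weight_ge (interval1 6) 6.
Proof.
apply: weight_ge_even; rewrite ?card_fset_seq //.
apply: (@weight_ge_split_seq 5 0 1 _ 4 1) => //=; last exact: weight_ge_seq1.
apply: (@weight_ge_split_seq 3 0 1 _ 2 2) => //=; first exact: weight_ge_124.
exact: weight_ge_36.
Qed.

Lemma weight_ge_interval8 : weight_ge (interval1 8) 8.
Proof.
apply: weight_ge_even; rewrite ?card_fset_seq //.
apply: (@weight_ge_split_seq 7 0 1 _ 6 1) => //=; last exact: weight_ge_seq1.
have -> : [fset x in [:: 1; 2; 3; 4; 5; 6; 8]] = 5 |` H.
  by apply/fsetP => x; rewrite !inE; lia.
apply: weight_ge_adjoin_prime weight_ge_H card_oddexp_H; rewrite ?inE //.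
by move=> b; rewrite !inE !orbF => /or4P[||| /or3P[]] /eqP->.
Qed.

Theorem theorem1p3 (n : nat) (A : {fset nat}) :
  1 <= n -> n <= 8 -> 0 \notin A -> A != fset0 ->
  n <= #|` oddprod A (interval1 n)|.
Proof.
move=> n1 n8 A0 A1; suff: weight_ge (interval1 n) n by apply.
have w2 : weight_ge (interval1 2) 2.
  by apply: (@weight_ge_split_seq 2 0 1 _ 1 1); rewrite //=; apply: weight_ge_seq1.
case: n n1 n8 => [//|[|[|[|[|[|[|[|[|//]]]]]]]]] _ _ //.
- exact: weight_ge_seq1.
- by apply: (@weight_ge_split_seq 3 0 1 _ 2 1); rewrite //=; apply: weight_ge_seq1.
- exact: weight_ge_interval4.
- apply: (@weight_ge_split_seq 5 0 1 _ 4 1) => //=.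
    exact: weight_ge_interval4.
  exact: weight_ge_seq1.
- exact: weight_ge_interval6.
- apply: (@weight_ge_split_seq 7 0 1 _ 6 1) => //=.
    exact: weight_ge_interval6.
  exact: weight_ge_seq1.
exact: weight_ge_interval8.
Qed.
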